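(* Let $(E,T,S,e)$ be a conditional expectation preserving system with $T$ strictly positive and $S$ surjective. Let $q$ be a component of $e$ and let $p$ be a component of $q$. Then $p$ is recurrent with respect to $q$.
   Context: $\mathbb{N}=\{1,2,3,\dots\}$. A conditional expectation on a Riesz space $E$ with weak order unit is a positive order continuous (linear) projection $T:E\to E$ whose range $R(T)$ is a Dedekind complete Riesz subspace of $E$ and such that $Te$ is a weak order unit of $E$ for each weak order unit $e$ of $E$. A conditional expectation preserving system is a 4-tuple $(E,T,S,e)$ where $E$ is a Dedekind complete Riesz space, $e$ is a weak order unit of $E$, $T$ is a conditional expectation on $E$ with $Te=e$, and $S$ is an order continuous Riesz homomorphism on $E$ with $Se=e$ and $TS=T$. $T$ is strictly positive if $f\in E$, $f\ge 0$ and $Tf=0$ imply $f=0$. For $q\in E$, $q\ge 0$, an element $p\in E$ is a component of $q$ if $0\le p\le q$ and $p\wedge(q-p)=0$. Recurrence: for components $p,q$ of $e$ with $p\le q$, $p$ is recurrent with respect to $q$ if there are components $p_n$ ($n\in\mathbb{N}$) of $p$ such that $\bigvee_{n\in\mathbb{N}}p_n=p$ and $S^np_n\le q$ for each $n\in\mathbb{N}$. *)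

(* Defs.v *)
From HB Require Import structures.
From mathcomp Require Import all_boot all_order all_algebra.
From mathcomp Require Import boolp classical_sets reals.

Set Implicit Arguments.
Unset Strict Implicit.
Unset Printing Implicit Defensive.

Import Order.TTheory GRing.Theory Num.Theory.
Local Open Scope classical_set_scope.
Local Open Scope ring_scope.

(* A Riesz space is an ordered vector space in which any two elements have a
   supremum and an infimum. These are fields of the mixin because HB does not
   allow the join of [GRing.Lmodule] and [Order.Lattice] to be declared after
   [Num.RealDomain]; the lattice structure is recovered just below. *)
HB.mixin Record Lmodule_POrder_isRiesz (R : realType) E
    of GRing.Lmodule R E & Order.isPOrder ring_display E := {
  riesz_leD2r : forall z x y : E, x <= y -> x + z <= y + z ;
  riesz_scale_ge0 : forall (a : R) (x : E), 0 <= a -> 0 <= x -> 0 <= a *: x ;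
  riesz_meet : E -> E -> E ;
  riesz_join : E -> E -> E ;
  riesz_lexI : forall x y z : E, (x <= riesz_meet y z) = (x <= y) && (x <= z) ;
  riesz_leUx : forall x y z : E, (riesz_join x y <= z) = (x <= z) && (y <= z)
}.

#[short(type="rieszType")]
HB.structure Definition Riesz (R : realType) :=
  { E of GRing.Lmodule R E & Order.isPOrder ring_display E
       & Lmodule_POrder_isRiesz R E }.

#[non_forgetful_inheritance]
HB.instance Definition _ (R : realType) (E : rieszType R) :=
  Order.POrder_isMeetSemilattice.Build ring_display (Riesz.sort E)
    (@riesz_lexI R E).

#[non_forgetful_inheritance]
HB.instance Definition _ (R : realType) (E : rieszType R) :=
  Order.POrder_isJoinSemilattice.Build ring_display (Riesz.sort E)
    (@riesz_leUx R E).

(* In this file [`|`] and [`&`] between vectors are the lattice operations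
   (delimited by %O), between sets they are union and intersection. *)

Section RieszSpaces.
Context {R : realType} {E : rieszType R}.
Implicit Types (A B F : set E) (x y e f p q : E) (T S : {linear E -> E}).

Definition rabs x : E := (x `|` - x)%O.

Definition linear_subspace F : Prop :=
  F 0 /\ forall (a : R) x y, F x -> F y -> F (a *: x + y).

Definition riesz_subspace F : Prop :=
  linear_subspace F /\
  forall x y, F x -> F y -> F (x `|` y)%O /\ F (x `&` y)%O.

(* Dedekind completeness of [F] with the order induced from [E]: upper bounds
   and suprema are taken within [F], and such a supremum need not be a supremum
   in [E]. *)
Definition dedekind_complete F : Prop :=
  forall A, A `<=` F -> A !=set0 -> (exists2 u, F u & ubound A u) ->
  exists s, [/\ F s, ubound A s & forall u, F u -> ubound A u -> s <= u].

Definition order_ideal B : Prop :=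
  linear_subspace B /\ forall x y, rabs x <= rabs y -> B y -> B x.

Definition band B : Prop :=
  order_ideal B /\ forall A s, A `<=` B -> supremums A s -> B s.

(* The band generated by [e] is the whole space. *)
Definition weak_order_unit e : Prop :=
  0 <= e /\ forall B, band B -> B e -> B = [set: E].

Definition directed_preorder (I : Type) (le : I -> I -> Prop) : Prop :=
  [/\ inhabited I, forall i, le i i,
      forall i j k, le i j -> le j k -> le i k
    & forall i j, exists k, le i k /\ le j k].

(* [|x_i - l| <= y_i] for some net [y] decreasing to 0. *)
Definition order_cvg (I : Type) (le : I -> I -> Prop) (x_ : I -> E) (l : E)
    : Prop :=
  exists y_ : I -> E,
    [/\ forall i j, le i j -> y_ j <= y_ i, infimums (range y_) 0
      & forall i, rabs (x_ i - l) <= y_ i].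

Definition order_continuous T : Prop :=
  forall (I : Type) (le : I -> I -> Prop), directed_preorder le ->
  forall (x_ : I -> E) (l : E),
    order_cvg le x_ l -> order_cvg le (fun i => T (x_ i)) (T l).

Definition positive_operator T : Prop := forall f, 0 <= f -> 0 <= T f.

Definition strictly_positive T : Prop := forall f, 0 <= f -> T f = 0 -> f = 0.

Definition riesz_homomorphism S : Prop :=
  forall x y, S (x `|` y)%O = (S x `|` S y)%O /\
              S (x `&` y)%O = (S x `&` S y)%O.

Record conditional_expectation T : Prop := {
  ce_positive : positive_operator T ;
  ce_order_continuous : order_continuous T ;
  ce_projection : forall f, T (T f) = T f ;
  ce_range_riesz : riesz_subspace (range T) ;
  ce_range_complete : dedekind_complete (range T) ;
  ce_unit : forall e, weak_order_unit e -> weak_order_unit (T e)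
}.

Record conditional_expectation_preserving_system T S e : Prop := {
  ceps_complete : dedekind_complete [set: E] ;
  ceps_unit : weak_order_unit e ;
  ceps_expectation : conditional_expectation T ;
  ceps_Te : T e = e ;
  ceps_order_continuous : order_continuous S ;
  ceps_homomorphism : riesz_homomorphism S ;
  ceps_Se : S e = e ;
  ceps_TS : forall f, T (S f) = T f
}.

Definition component p q : Prop :=
  [/\ 0 <= p, p <= q & (p `&` (q - p))%O = 0].

Definition recurrent S p q : Prop :=
  exists p_ : nat -> E,
    [/\ forall n, (0 < n)%N -> component (p_ n) p,
        supremums [set p_ n | n in [set n | (0 < n)%N]] p
      & forall n, (0 < n)%N -> iter n S (p_ n) <= q].

End RieszSpaces.

(* Main.v *)
Require Import Defs.
From HB Require Import structures.
From mathcomp Require Import all_boot all_order all_algebra.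
From mathcomp Require Import boolp classical_sets reals.
Import Order.TTheory GRing.Theory Num.Theory.
Local Open Scope classical_set_scope.
Local Open Scope ring_scope.

(** This is Poincare recurrence for an invertible measure preserving map. The
    operator [S] is injective, since [T \o S = T] and [T] is strictly positive,
    so it is a lattice automorphism fixing [e] and [q] has a preimage [q_ n]
    under each [S^n], again a component of [e]. Take [p_ n] to be the meet of
    [p] and [q_ n]: the points of [p] which are in [q] at time [n].

    If [u] bounds every [p_ n], the excess [d] of [p] over its meet with [u] is
    disjoint from every [q_ n] with [0 < n], hence [S^n d] is disjoint from [q],
    and from [d], which lies below [q]. Thus [d] is wandering: its iterates
    [S^n d] are pairwise disjoint. They all lie below [e], and so do their
    finite sums ([sum_wandering_le]). Applying [T] gives [T d *+ n <= e] for
    every [n]; a Dedekind complete Riesz space is Archimedean ([archimedean]),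
    so [T d = 0] and [d = 0], that is, [p <= u]. *)

(** * Ordered vector spaces and disjointness *)

Section RieszArithmetic.
Context {R : realType} {E : rieszType R}.
Implicit Types x y z w c d e p u : E.

Lemma rleD2r z x y : (x + z <= y + z) = (x <= y).
Proof.
apply/idP/idP => [h|]; last exact: riesz_leD2r.
by rewrite -[x](addrK z) -[y](addrK z) riesz_leD2r.
Qed.

Lemma rleBlDr x y z : (x - y <= z) = (x <= z + y).
Proof. by rewrite -(rleD2r y (x - y)) subrK. Qed.

Lemma rsubr_ge0 x y : (0 <= x - y) = (y <= x).
Proof. by rewrite -(rleD2r y 0) subrK add0r. Qed.

Lemma rleD2l z x y : (z + x <= z + y) = (x <= y).
Proof. by rewrite ![z + _]addrC rleD2r. Qed.

Lemma rleB2l z x y : (z - x <= z - y) = (y <= x).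
Proof. by rewrite -[LHS]rsubr_ge0 opprB addrC addrA subrK rsubr_ge0. Qed.

Lemma rle_addr x y : 0 <= y -> x <= x + y.
Proof. by move=> y0; rewrite -{1}[x]addr0 rleD2l. Qed.

Lemma raddr_ge0 x y : 0 <= x -> 0 <= y -> 0 <= x + y.
Proof. by move=> x0 y0; apply: le_trans x0 (rle_addr _ _ y0). Qed.

Lemma disjoint_le x y x' y' : (x `&` y)%O = 0 ->
  0 <= x' <= x -> 0 <= y' <= y -> (x' `&` y')%O = 0.
Proof.
move=> xy /andP[x0 xx] /andP[y0 yy]; apply/eqP; rewrite eq_le lexI x0 y0.
by rewrite andbT -xy leI2.
Qed.

Lemma disjointD x y z : 0 <= x -> 0 <= y -> 0 <= z ->
  (x `&` z)%O = 0 -> (y `&` z)%O = 0 -> ((x + y) `&` z)%O = 0.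
Proof.
move=> x0 y0 z0 xz yz; apply/eqP; rewrite eq_le lexI z0 raddr_ge0 // !andbT.
set w := (_ `&` _)%O.
have wz : w <= z by rewrite leIr.
(* [w - y] lies below [x], and below [z] because [0 <= y] *)
have wy : w <= y.
  rewrite -[y]add0r -xz -rleBlDr lexI !rleBlDr leIl /=.
  exact: le_trans wz (rle_addr _ _ y0).
by rewrite -yz lexI wy.
Qed.

(** The excess [x + y - e] lies below both [y] and [x], hence below their
    meet. *)
Lemma disjointD_le x y e : (x `&` y)%O = 0 -> x <= e -> y <= e -> x + y <= e.
Proof.
move=> xy xe ye; rewrite -[e]add0r -xy -rleBlDr lexI !rleBlDr.
by rewrite rleD2l ye addrC rleD2l.
Qed.

(** The upper bound holds because [p - p `&` c] is [p `|` c - c] and [e] is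
    above both [p] and [c]. It makes the part of [p] outside [c] disjoint from
    [c] when [c] is a component of [e]. *)
Lemma component_diff_le c e p : p <= e -> c <= e ->
  0 <= p - (p `&` c)%O <= e - c.
Proof.
move=> pe ce; rewrite rsubr_ge0 leIl /= rleBlDr addrC -rleBlDr lexI.
by rewrite !rleBlDr rle_addr ?rsubr_ge0 //= addrC subrK.
Qed.

Lemma component_meet c e p : component c e -> 0 <= p -> p <= e ->
  component (p `&` c)%O p.
Proof.
move=> [c0 ce cec] p0 pe; have h := component_diff_le _ _ _ pe ce.
split; [by rewrite lexI p0|exact: leIl|].
by apply: (disjoint_le _ _ _ _ cec); rewrite // lexI p0 c0 leIr.
Qed.

(** The supremum [s] of the multiples of [x] satisfies [s <= s - x]. *)
Lemma archimedean x u : dedekind_complete [set: E] ->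
  (forall n, x *+ n <= u) -> x <= 0.
Proof.
move=> dc xu; have [|||s [_ sub sleast]] := dc (range (fun n => x *+ n)).
- by [].
- by exists (x *+ 0), 0%N.
- by exists u => // _ [n _ <-].
have : s <= s - x.
  apply: sleast => // _ [n _ <-]; rewrite -(rleD2r x) subrK -mulrSr.
  by apply: sub; exists n.+1.
by rewrite -{1}[s]addr0 rleD2l -(rleD2r x) add0r addNr.
Qed.

End RieszArithmetic.

(** * Iterates of an injective Riesz homomorphism *)

Section Iterates.
Context {R : realType} {E : rieszType R} {S : {linear E -> E}}.
Hypotheses (S_hom : riesz_homomorphism S) (S_inj : injective S).
Implicit Types x y d e : E.

Lemma iter_linear0 n : iter n S 0 = 0.
Proof. by elim: n => //= n ->; rewrite linear0. Qed.

Lemma iter_linearB n x y : iter n S (x - y) = iter n S x - iter n S y.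
Proof. by elim: n => //= n ->; rewrite linearB. Qed.

Lemma iter_meet n x y :
  iter n S (x `&` y)%O = (iter n S x `&` iter n S y)%O.
Proof. by elim: n => //= n ->; case: (S_hom (iter n S x) (iter n S y)). Qed.

Lemma iter_inj n : injective (iter n S).
Proof. by elim: n => //= n IHn x y /S_inj /IHn. Qed.

Lemma iter_le n x y : (iter n S x <= iter n S y) = (x <= y).
Proof. by rewrite !leEmeet -iter_meet (inj_eq (iter_inj n)). Qed.

Lemma iter_ge0 n x : (0 <= iter n S x) = (0 <= x).
Proof. by rewrite -{1}(iter_linear0 n) iter_le. Qed.

Lemma iter_fixed n e : S e = e -> iter n S e = e.
Proof. by move=> Se; elim: n => //= n ->. Qed.

Lemma component_iter n x e : S e = e ->
  component (iter n S x) e -> component x e.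
Proof.
move=> Se; rewrite -{1}(iter_fixed n _ Se) => -[x0 xe xex].
split; [by rewrite -(iter_ge0 n)|by rewrite -(iter_le n)|].
by apply: (iter_inj n); rewrite iter_meet iter_linearB xex iter_linear0.
Qed.

(** The sum of [n.+1] iterates is [d] plus the image under [S] of the sum of
    [n] iterates. Both terms lie below [e] = [S e], and they are disjoint since
    [d] is disjoint from each later iterate. *)
Lemma sum_wandering_le d e n : S e = e -> 0 <= d -> d <= e ->
  (forall k, (0 < k)%N -> (iter k S d `&` d)%O = 0) ->
  \sum_(k < n) iter k S d <= e.
Proof.
move=> Se d0 de dwand; elim: n => [|n IHn].
  by rewrite big_ord0; apply: le_trans d0 de.
have shiftE : \sum_(k < n) iter k.+1 S d = S (\sum_(k < n) iter k S d).
  by rewrite linear_sum.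
rewrite big_ord_recl addrC; apply: disjointD_le => //; last first.
  by rewrite shiftE -Se (iter_le 1).
suff [] : 0 <= \sum_(k < n) iter k.+1 S d /\
          ((\sum_(k < n) iter k.+1 S d) `&` d)%O = 0 by [].
elim/big_ind: _ => [|x y [x0 xd] [y0 yd]|k _].
- by split=> //; apply/eqP; rewrite -leEmeet.
- by split; [exact: raddr_ge0|exact: disjointD].
- by split; [rewrite (iter_ge0 k.+1)|exact: dwand].
Qed.

End Iterates.

(** * Conditional expectation preserving systems *)

Section Systems.
Context {R : realType} {E : rieszType R} {T S : {linear E -> E}} {e : E}.
Hypothesis sys : conditional_expectation_preserving_system T S e.
Hypothesis T_spos : strictly_positive T.

(** If [S x = 0], then the positive parts of [x] and [- x] are killed by [S],
    hence by [T = T \o S], hence vanish. *)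
Lemma system_inj : injective S.
Proof.
have kerS x : S x = 0 -> x <= 0.
  move=> Sx0; suff <- : (x `|` 0)%O = 0 by exact: leUl.
  apply: T_spos; first exact: leUr.
  rewrite -(ceps_TS sys); have [-> _] := ceps_homomorphism sys x 0.
  by rewrite Sx0 linear0 joinxx linear0.
move=> x y Sxy; apply/eqP; rewrite eq_le.
have := kerS (x - y); have := kerS (y - x).
rewrite !linearB Sxy subrr !rleBlDr !add0r => yx xy.
by rewrite xy // yx.
Qed.

(** There is no room below [e] for infinitely many disjoint copies of [d] with
    the same expectation. *)
Lemma wandering_eq0 d : 0 <= d -> d <= e ->
  (forall k, (0 < k)%N -> (iter k S d `&` d)%O = 0) -> d = 0.
Proof.
move=> d0 de dwand; apply: T_spos => //.
have Tpos := ce_positive (ceps_expectation sys).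
apply/eqP; rewrite eq_le (Tpos _ d0) andbT.
apply: (archimedean _ e (ceps_complete sys)) => n.
have Titer k : T (iter k S d) = T d.
  by elim: k => //= k IHk; rewrite (ceps_TS sys).
have -> : T d *+ n = T (\sum_(k < n) iter k S d).
  rewrite linear_sum (eq_bigr (fun=> T d)) => [|k _]; last exact: Titer.
  by rewrite sumr_const card_ord.
rewrite -[leRHS](ceps_Te sys) -rsubr_ge0 -linearB; apply: Tpos.
rewrite rsubr_ge0; apply: sum_wandering_le => //.
- exact: ceps_homomorphism sys.
- exact: system_inj.
- exact: ceps_Se sys.
Qed.

End Systems.

Theorem theorem3p2 (R : realType) (E : rieszType R) (T S : {linear E -> E})
    (e p q : E) :
  conditional_expectation_preserving_system T S e ->
  strictly_positive T ->
  (forall y : E, exists x : E, S x = y) ->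
  component q e ->
  component p q ->
  recurrent S p q.
Proof.
move=> sys T_spos S_surj qe [p0 pq _].
have [q0 q_le_e _] := qe.
have pe : p <= e := le_trans pq q_le_e.
have S_hom := ceps_homomorphism sys.
have S_inj := system_inj sys T_spos.
have Se := ceps_Se sys.
have iter_surj n y : exists x, iter n S x = y.
  elim: n y => [|n IHn] y; first by exists y.
  have [z <-] := S_surj y; have [x <-] := IHn z.
  by exists x.
have [q_ q_E] := choice (fun n => iter_surj n q).
have q_e n : component (q_ n) e.
  by apply: (component_iter S_hom S_inj n); rewrite ?q_E.
exists (fun n => (p `&` q_ n)%O); split.
- by move=> n _; apply: component_meet (q_e n) p0 pe.
- split=> [_ [n _ <-]|u u_ub]; first exact: leIl.
  set d := p - (p `&` u)%O.
  suff /eqP : d = 0 by rewrite subr_eq0 eq_sym -leEmeet.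
  have d0 : 0 <= d by rewrite rsubr_ge0 leIl.
  have dp : d <= p.
    rewrite -[leRHS]subr0 rleB2l lexI p0 /=.
    (* [0 <= u] because [u] bounds the component [p_ 1] *)
    apply: (le_trans _ (u_ub _ (ex_intro2 _ _ 1%N isT erefl))).
    by have [q10 _ _] := q_e 1%N; rewrite lexI p0.
  apply: (wandering_eq0 sys T_spos) => // [|n n0]; first exact: le_trans dp pe.
  have [qn0 qne qnC] := q_e n.
  have dqn : (d `&` q_ n)%O = 0.
    rewrite meetC; apply: (disjoint_le _ _ _ _ qnC); first by rewrite qn0 lexx.
    have /andP[_ h] := component_diff_le _ _ _ pe qne.
    rewrite d0 (le_trans _ h) // rleB2l lexI leIl /=.
    by apply: u_ub; exists n.
  have Sndq : (iter n S d `&` q)%O = 0.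
    by rewrite -(q_E n) -(iter_meet S_hom) dqn iter_linear0.
  apply: (disjoint_le _ _ _ _ Sndq).
    by rewrite (iter_ge0 S_hom S_inj) d0 lexx.
  by rewrite d0 (le_trans dp pq).
- by move=> n _; rewrite (iter_meet S_hom) q_E leIr.
Qed.
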